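(* Let $B = p^n$ where $p$ is a prime and $n \ge 1$ is an integer, and let $k \ge 1$. Then all solutions of $P^*_k$ in base $B$ are extensions of those of $P^*_1$; that is, every number $N_k = [a_1\dots a_k\, b\, c_1\dots c_k]$ (with $a_1\neq 0$) having property $P^*_k$ is obtained from a solution of $P^*_1$ in base $B$ by applying the extension operation $k-1$ times.
   Context: Fix an integer base $B \ge 2$. A digit is an integer $x$ with $0 \le x < B$, and for digits $x_1,\dots,x_m$ write $[x_1x_2\dots x_m] = \sum_{i=1}^m x_i B^{m-i}$. For $k \ge 1$ consider a number $N_k = [a_1\dots a_k\, b\, c_1\dots c_k]$ with digits $a_i, b, c_i$ and $a_1 \neq 0$, and put $a = [a_1\dots a_k]$, $c = [c_1\dots c_k]$. $N_k$ has property $P_k$ if $[a_1\dots a_k\, b]\cdot[c_1\dots c_k] = [a_1\dots a_k]\cdot[b\, c_1\dots c_k]$, equivalently $(aB+b)c = a(bB^k + c)$. $N_k$ has property $P^*_k$ (is a solution of $P^*_k$) if it has property $P_k$, no two of $a, b, c$ are $0$, and the digits $a_1,\dots,a_k,b,c_1,\dots,c_k$ are not all equal. The extension of $N = [a_1\dots a_k\, b\, c_1\dots c_k]$ is the number $N^+ = [a_1\dots a_k\, b\,b\,b\, c_1\dots c_k]$ obtained by replacing the central digit $b$ by three copies of $b$ (it is regarded as a $(2k+3)$-digit number with central digit $b$); applying the operation $0$ times leaves $N$ unchanged. *)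

(* Defs.v *)
From mathcomp Require Import all_boot.

Set Implicit Arguments.
Unset Strict Implicit.
Unset Printing Implicit Defensive.

(* [x_1 x_2 ... x_m] in base B, most significant digit first; the 0-based     *)
(* index i stands for x_(i+1).                                                *)
Definition value (B : nat) (x : seq nat) : nat :=
  \sum_(i < size x) nth 0 x i * B ^ (size x - i.+1).

(* A number [a_1 ... a_k b c_1 ... c_k] is represented by its digits together *)
(* with the position of the central one. Nothing is enforced here: the digit  *)
(* bounds, the lengths and a_1 != 0 are part of property_P.                   *)
Record numeral := Numeral {
  left_digits : seq nat;
  central_digit : nat;
  right_digits : seq nat
}.

Definition digits (N : numeral) : seq nat :=
  left_digits N ++ central_digit N :: right_digits N.

Definition property_P (B k : nat) (N : numeral) : Prop :=
  let: Numeral a b c := N in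
  [/\ size a = k,
      size c = k,
      all (fun x => x < B) (digits N),
      head 0 a != 0 &
      value B (rcons a b) * value B c = value B a * value B (b :: c)].

Definition property_Pstar (B k : nat) (N : numeral) : Prop :=
  let: Numeral a b c := N in
  [/\ property_P B k N,
      ~ (value B a = 0 /\ b = 0),
      ~ (value B a = 0 /\ value B c = 0),
      ~ (b = 0 /\ value B c = 0) &
      ~~ constant (digits N)].

(* The middle one of the three copies of b is the new central digit.          *)
Definition extension (N : numeral) : numeral :=
  let: Numeral a b c := N in Numeral (rcons a b) b (b :: c).

Lemma digits_extension (a : seq nat) (b : nat) (c : seq nat) :
  digits (extension (Numeral a b c)) = a ++ [:: b; b; b] ++ c.
Proof. by rewrite /digits /= cat_rcons. Qed.

(* Main.v *)
Require Import Defs.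
From mathcomp Require Import all_boot zify.

(** Write [B] for the base, [a], [b], [c] for the three parts of a solution,
    and [k = m + 1].  The defining equation reads [c * D = a * b * B ^ k] with
    [D = a * (B - 1) + b].  In terms of [f = b * B ^ k - c * (B - 1)] it becomes
    the factorization [f * D = b ^ 2 * B ^ k].

    Both [D] and [f] are congruent to [b] modulo [B - 1], since [B] is congruent
    to [1], and [a_1 != 0] makes [D > b * B ^ m], so that [0 < f < b * B].
    Hence [B] does not divide [f]: a quotient would lie strictly between [0]
    and [b <= B - 1] and still be congruent to [b] modulo [B - 1]
    ([not_dvdn_cofactor]).  When [B] is a power of a prime [p], this says that
    the [p]-part of [f] is a proper divisor of [B], so [B ^ m] divides [D]
    ([dvdn_prime_power_cofactor]).

    Writing [D = B ^ m * e], the congruences modulo [B - 1] give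
    [e = a_1 * (B - 1) + b] and [f = b * B - c_1 * (B - 1)] for some digits
    [a_1] and [c_1], and [f * e = b ^ 2 * B] is the equation for the three-digit
    number with digits [a_1], [b], [c_1].  The resulting values of [a] and [c]
    are those of [a_1 b ... b] and [b ... b c_1], and digits are determined
    by the value ([value_inj]). *)

(** * Values of digit sequences *)

Lemma value_rcons (B : nat) (s : seq nat) (x : nat) :
  value B (rcons s x) = value B s * B + x.
Proof.
rewrite /value size_rcons big_ord_recr /= nth_rcons ltnn eqxx subnn muln1.
congr (_ + _); rewrite big_distrl; apply: eq_bigr => i _ /=.
by rewrite nth_rcons ltn_ord subSn // expnSr mulnA.
Qed.

Lemma value_cons (B x : nat) (s : seq nat) :
  value B (x :: s) = x * B ^ size s + value B s.
Proof. by rewrite /value big_ord_recl /= subn1. Qed.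

Lemma value_nil (B : nat) : value B [::] = 0.
Proof. by rewrite /value big_ord0. Qed.

Lemma value_seq1 (B x : nat) : value B [:: x] = x.
Proof. by rewrite value_cons value_nil muln1 addn0. Qed.

Lemma value_lt (B : nat) (s : seq nat) :
  all (fun x => x < B) s -> value B s < B ^ size s.
Proof.
elim/last_ind: s => [|s x IHs]; first by rewrite value_nil.
rewrite all_rcons value_rcons size_rcons expnSr => /andP[x_lt /IHs s_lt].
by have := leq_mul s_lt (leqnn B); rewrite mulSn; lia.
Qed.

Lemma value_inj (B : nat) (s t : seq nat) :
  all (fun x => x < B) s -> all (fun x => x < B) t ->
  size s = size t -> value B s = value B t -> s = t.
Proof.
elim/last_ind: s t => [|s x IHs] t; first by case: t.
case/lastP: t => [|t y]; rewrite ?size_rcons // !all_rcons !value_rcons.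
move=> /andP[x_lt s_lt] /andP[y_lt t_lt] [eq_size] eq_val.
have B_gt0 : 0 < B by apply: leq_trans x_lt.
have eq_x : x = y.
  by have := congr1 (modn^~ B) eq_val; rewrite !modnMDl !modn_small.
have eq_s : value B s = value B t.
  have := congr1 (divn^~ B) eq_val.
  by rewrite !divnMDl // !divn_small // !addn0.
by rewrite (IHs t s_lt t_lt eq_size eq_s) eq_x.
Qed.

Lemma nseqSr (T : Type) (m : nat) (x : T) : nseq m.+1 x = rcons (nseq m x) x.
Proof. by rewrite -addn1 nseqD cats1. Qed.

(** Telescoping: multiplying by [B - 1] sums the geometric series of [b]'s. *)
Lemma value_cons_nseq (q x b m : nat) :
  value q.+1 (x :: nseq m b) * q + b = q.+1 ^ m * (x * q + b).
Proof.
elim: m => [|m IHm]; first by rewrite value_seq1 mul1n.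
by rewrite nseqSr -rcons_cons value_rcons expnS; nia.
Qed.

Lemma value_rcons_nseq (q b y m : nat) :
  value q.+1 (rcons (nseq m b) y) * q + b * q.+1
  = b * q.+1 ^ m.+1 + y * q.
Proof.
elim: m => [|m IHm]; first by rewrite value_seq1 expn1 addnC.
rewrite /= value_cons size_rcons size_nseq.
by rewrite [q.+1 ^ m.+2]expnS; nia.
Qed.

(** * Iterated extensions *)

Lemma iter_extension (m x b y : nat) :
  iter m extension (Numeral [:: x] b [:: y])
  = Numeral (x :: nseq m b) b (rcons (nseq m b) y).
Proof.
by elim: m => [|m IHm] //; rewrite iterS IHm /= -nseqSr.
Qed.

Lemma constant_iter_extension (m x b y : nat) :
  constant (digits (Numeral [:: x] b [:: y])) ->
  constant (digits (iter m extension (Numeral [:: x] b [:: y]))).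
Proof.
rewrite iter_extension /digits /= andbT => /andP[/eqP -> /eqP ->].
by rewrite all_cat /= all_rcons all_nseq /= eqxx orbT.
Qed.

(** * The arithmetic of solutions *)

Lemma modn_expn_succ_mul (q j x : nat) : q.+1 ^ j * x = x %[mod q].
Proof.
by rewrite -modnMml -modnXm -addn1 modnDl modnXm exp1n modnMml mul1n.
Qed.

(** The quotient [f / B] would be congruent to [b] modulo [B - 1], positive and
    smaller than [b <= B - 1]. Here [B = q + 1]. *)
Lemma not_dvdn_cofactor (q b f : nat) :
  0 < f -> f < b * q.+1 -> b <= q -> f = b %[mod q] -> ~~ (q.+1 %| f).
Proof.
move=> f_gt0 f_lt b_le f_mod; apply/negP => /dvdnP[g f_def].
have g_gt0 : 0 < g by case: g f_def f_gt0 => // ->.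
have g_lt : g < b by move: f_lt; rewrite f_def ltn_pmul2r.
have /eqP : b = g %[mod q] by rewrite -f_mod f_def mulnS addnC modnMDl.
rewrite (eqn_mod_dvd q (ltnW g_lt)) => /dvdn_leq; lia.
Qed.

(** Comparing [p]-adic valuations: that of [f] is below [n]. Composite bases
    fail here, because a non-multiple of [B] may still share primes with [B]
    and absorb their powers: [6 ^ 2] divides [4 * 9], but [6] divides neither
    [4] nor [9]. *)
Lemma dvdn_prime_power_cofactor (p n m f D : nat) :
  prime p -> 0 < f -> 0 < D -> ~~ (p ^ n %| f) ->
  (p ^ n) ^ m.+1 %| f * D -> (p ^ n) ^ m %| D.
Proof.
move=> p_pr f_gt0 D_gt0; rewrite -!expnM !pfactor_dvdn ?muln_gt0 ?f_gt0 //.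
by rewrite lognM // mulnS; lia.
Qed.

(** The core of the argument, on values instead of digit sequences.
    The two conclusions with [a] and [c] say, after division by [q], that [a]
    and [c] have digits [x b ... b] and [b ... b y]; they are kept multiplied
    by [q] to match the telescoping formulas. *)
Lemma solution_outer_digits (p n q m a b c : nat) :
  prime p -> p ^ n = q.+1 -> 0 < q -> 0 < b <= q ->
  q.+1 ^ m <= a < q.+1 ^ m.+1 ->
  c * (a * q + b) = a * b * q.+1 ^ m.+1 ->
  exists x y : nat,
    [/\ 0 < x <= q, y <= q,
        a * q + b = q.+1 ^ m * (x * q + b),
        c * q + b * q.+1 = b * q.+1 ^ m.+1 + y * q &
        y * (x * q + b) = x * b * q.+1].
Proof.
move=> p_pr def_B q_gt0 /andP[b_gt0 b_le] /andP[a_ge a_lt] eqn_c.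
set P := q.+1 ^ m in a_ge.
have P_gt0 : 0 < P by rewrite expn_gt0.
have a_gt0 : 0 < a by apply: leq_trans a_ge.
rewrite expnS -/P in a_lt eqn_c *.
set D := a * q + b in eqn_c *.
have D_gt0 : 0 < D by rewrite /D; lia.
have cq_le : c * q <= b * (q.+1 * P).
  rewrite -(leq_pmul2l a_gt0) mulnA [a * (b * _)]mulnA -eqn_c; rewrite /D; nia.
set f := b * (q.+1 * P) - c * q.
have f_def : f + c * q = b * (q.+1 * P) by rewrite subnK.
have fD : f * D = b * b * (q.+1 * P).
  have : f * D + (c * D) * q = b * (q.+1 * P) * D.
    by rewrite -f_def mulnDl; congr (_ + _); rewrite mulnAC.
  rewrite eqn_c {2}/D; nia.
have f_gt0 : 0 < f.
  by move: fD; case: (f) => // /esym/eqP; rewrite mul0n !muln_eq0; lia.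
(* The bounds [a >= P] and [b <= q] give [D >= q * P + b >= b * P + b]. *)
have D_gt : b * P < D by rewrite /D; nia.
have f_lt : f < b * q.+1.
  rewrite -(ltn_pmul2r D_gt0) fD.
  have -> : b * b * (q.+1 * P) = b * q.+1 * (b * P) by lia.
  by rewrite ltn_pmul2l // muln_gt0 b_gt0.
have f_mod : f = b %[mod q].
  rewrite -(modnMDl c f) addnC f_def.
  by rewrite -expnS mulnC modn_expn_succ_mul.
have B_ndvd : ~~ (q.+1 %| f) by apply: (not_dvdn_cofactor q b f).
have /dvdnP[e D_def] : P %| D.
  rewrite /P -def_B; apply: (dvdn_prime_power_cofactor p n m f) => //.
    by rewrite def_B.
  by rewrite def_B expnS -/P fD dvdn_mull.
have e_gt : b < e by move: D_gt; rewrite D_def ltn_pmul2r.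
have fe : f * e = b * b * q.+1.
  by apply/eqP; rewrite -(eqn_pmul2r P_gt0) -mulnA -D_def fD mulnA.
(* Casting out [q]: [P] is [1] modulo [q], so [e], [D] and [b] agree. *)
have e_mod : e = b %[mod q].
  by rewrite -(modn_expn_succ_mul q m e) mulnC -D_def modnMDl.
have /dvdnP[x x_def] : q %| e - b.
  by rewrite -(eqn_mod_dvd q (ltnW e_gt)) e_mod.
have e_def : e = x * q + b by lia.
have /dvdnP[y y_def] : q %| b * q.+1 - f.
  rewrite -(eqn_mod_dvd q (ltnW f_lt)) f_mod.
  by rewrite mulnS addnC modnMDl.
have y_eq : f + y * q = b * q.+1 by lia.
clear fD D_gt f_mod f_lt B_ndvd e_mod x_def y_def eqn_c cq_le; clearbody f.
exists x, y; split.
- apply/andP; split; first by case: (x) e_def e_gt => // ->; lia.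
  rewrite -ltnS -(ltn_pmul2r P_gt0); apply: leq_ltn_trans a_lt.
  (* It remains to see [x * P <= a]: [x] is the leading digit of [a]. *)
  rewrite -(leq_pmul2r q_gt0); have := leq_pmulr b P_gt0.
  by move: D_def; rewrite e_def /D; lia.
- (* As [f > 0], [y * q < b * q.+1 <= q * q.+1]. *)
  rewrite -ltnS -(ltn_pmul2r q_gt0).
  by have := leq_mul b_le (leqnn q.+1); lia.
- by rewrite D_def e_def mulnC.
- by rewrite -f_def -y_eq addnA (addnC _ f).
- (* Cancel [f * e] in [(f + y * q) * e = b * q.+1 * (x * q + b)]. *)
  clear f_def; apply/eqP; rewrite -(eqn_pmul2r q_gt0); apply/eqP; move: fe.
  have -> : y * (x * q + b) * q = y * q * e by rewrite e_def; lia.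
  have : (f + y * q) * e = b * q.+1 * e by rewrite y_eq.
  by rewrite {2}e_def; lia.
Qed.

(** * Solutions in prime power bases *)

Theorem theorem6 (p n k : nat) (p_prime : prime p) (n_ge1 : 1 <= n)
    (k_ge1 : 1 <= k) (N : numeral) :
  property_Pstar (p ^ n) k N ->
  exists2 M : numeral,
    property_Pstar (p ^ n) 1 M & N = iter (k - 1) extension M.
Proof.
case: k k_ge1 => // m _; rewrite subn1 /=; case: N => a b c.
have : 1 < p ^ n by rewrite -{1}(expn0 p) ltn_exp2l ?prime_gt1.
case def_B: (p ^ n) => [|q] // q_gt0.
case=> -[size_a size_c dig head_a eqn] _ _ bc_nz nconst.
move: (dig); rewrite /digits all_cat /= => /and3P[dig_a b_lt dig_c].
have a_ge : q.+1 ^ m <= value q.+1 a.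
  case: a size_a head_a {eqn nconst dig dig_a} => // x s [<-] /= x_nz.
  by rewrite value_cons; move: x_nz; rewrite -lt0n; nia.
have a_lt : value q.+1 a < q.+1 ^ m.+1 by rewrite -size_a value_lt.
have P_gt0 : 0 < q.+1 ^ m by rewrite expn_gt0.
rewrite value_rcons value_cons size_c in eqn.
have eqn_c : value q.+1 c * (value q.+1 a * q + b)
             = value q.+1 a * b * q.+1 ^ m.+1 by nia.
(* If [b = 0], then [eqn_c] forces [c = 0], as [a] and [q] are positive. *)
have b_gt0 : 0 < b.
  rewrite lt0n; apply/eqP => b0; apply: bc_nz; split=> //.
  by move: eqn_c; rewrite b0 addn0 muln0 mul0n => /eqP; rewrite !muln_eq0; lia.
have [||x [y [x_bd y_le a_eq c_eq xy_eq]]] :=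
  solution_outer_digits p n q m (value q.+1 a) b (value q.+1 c)
    p_prime def_B q_gt0 _ _ eqn_c.
- by rewrite b_gt0.
- by rewrite a_ge.
have /andP[x_gt0 x_le] := x_bd.
have y_gt0 : 0 < y.
  by rewrite lt0n; apply/eqP => y0; move: xy_eq; rewrite y0 mul0n; nia.
have a_def : a = x :: nseq m b.
  apply: (value_inj q.+1) => //=; first by rewrite ltnS x_le all_nseq b_lt orbT.
    by rewrite size_nseq.
  apply/eqP; rewrite -(eqn_pmul2r q_gt0) -(eqn_add2r b).
  by rewrite value_cons_nseq a_eq.
have c_def : c = rcons (nseq m b) y.
  apply: (value_inj q.+1) => //=.
  - by rewrite all_rcons ltnS y_le all_nseq b_lt orbT.
  - by rewrite size_rcons size_nseq.
  apply/eqP; rewrite -(eqn_pmul2r q_gt0) -(eqn_add2r (b * q.+1)).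
  by rewrite value_rcons_nseq c_eq.
have N_def : Numeral a b c = iter m extension (Numeral [:: x] b [:: y]).
  by rewrite iter_extension -a_def -c_def.
exists (Numeral [:: x] b [:: y]) => //; split; last first.
- by apply: contra nconst; rewrite N_def; apply: constant_iter_extension.
- by rewrite value_seq1; lia.
- by rewrite !value_seq1; lia.
- by rewrite value_seq1; lia.
split=> //=; first by rewrite !ltnS x_le y_le -ltnS b_lt.
  by rewrite -lt0n.
by rewrite (value_rcons _ [:: x]) (value_cons _ b) !value_seq1 /= expn1; lia.
Qed.
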